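(* Let $\{x_k\}$ be a sequence of nonstationary points and $\{u_k\}$ the sequence of directions generated by the Newton algorithm (described in the context), and suppose that $\{x_k\}$ is convergent. Then the sequence $\{u_k\}$ is bounded.
   Context: $K\subseteq\mathbb{R}^m$ is a closed, convex, pointed ($K\cap(-K)=\{0\}$), solid ($\operatorname{int}K\neq\emptyset$) cone. For $y,z\in\mathbb{R}^m$: $y\preceq z$ iff $z-y\in K$, and $y\prec z$ iff $z-y\in\operatorname{int}(K)$. Standing assumption: $F(x)=\{f^1(x),\ldots,f^p(x)\}$ for $x\in\mathbb{R}^n$, where $f^1,\ldots,f^p:\mathbb{R}^n\to\mathbb{R}^m$ are twice continuously differentiable and $K$-strongly convex with respect to a common $e\in\operatorname{int}(K)$: there are $\rho_1,\ldots,\rho_p>0$ such that for every $i\in[p]=\{1,\ldots,p\}$, $x_1,x_2\in\mathbb{R}^n$, $\lambda\in[0,1]$, $f^i(\lambda x_1+(1-\lambda)x_2)\preceq\lambda f^i(x_1)+(1-\lambda)f^i(x_2)-\tfrac12\rho_i\lambda(1-\lambda)\|x_1-x_2\|^2e$. For $f^i=(f^{i,1},\ldots,f^{i,m})^\top$ and $u\in\mathbb{R}^n$, $\nabla f^i(x)^\top u\in\mathbb{R}^m$ denotes the Jacobian of $f^i$ at $x$ applied to $u$, and $u^\top\nabla^2f^i(x)u$ denotes the vector $(u^\top\nabla^2f^{i,1}(x)u,\ldots,u^\top\nabla^2f^{i,m}(x)u)^\top\in\mathbb{R}^m$. Gerstewitz function: $\Psi_e(z)=\min\{t\in\mathbb{R}: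 te\in z+K\}$, $z\in\mathbb{R}^m$. $\operatorname{Min}(A,K)=\{z\in A:(z-K)\cap A=\{z\}\}$. $I(x)=\{i\in[p]:f^i(x)\in\operatorname{Min}(F(x),K)\}$; $w(x)=|\operatorname{Min}(F(x),K)|$; for $r\in\mathbb{R}^m$, $I_r(x)=\{i\in I(x):f^i(x)=r\}$. Fixing an enumeration $\{r_1^x,\ldots,r_{w(x)}^x\}$ of $\operatorname{Min}(F(x),K)$, the partition set at $x$ is $P_x=\prod_{j=1}^{w(x)}I_{r_j^x}(x)$; its elements are written $a=(a_1,\ldots,a_{w(x)})$. Stationary point: $\bar x$ is stationary if for every $a\in P_{\bar x}$ and every $u\in\mathbb{R}^n$ there exists $j\in[w(\bar x)]$ with $\nabla f^{a_j}(\bar x)^\top u\notin-\operatorname{int}(K)$; otherwise it is nonstationary. For $x\in\mathbb{R}^n$, $a\in P_x$, $u\in\mathbb{R}^n$: $\xi_x(a,u)=\max_{j\in[w(x)]}\Psi_e\big(\nabla f^{a_j}(x)^\top u+\tfrac12u^\top\nabla^2f^{a_j}(x)u\big)$. Newton algorithm: given $x_0\in\mathbb{R}^n$, $\beta\in(0,1)$, $\nu\in(0,1)$, for $k=0,1,2,\ldots$: choose $(a^k,u_k)\in\operatorname{argmin}_{(a,u)\in P_{x_k}\times\mathbb{R}^n}\xi_{x_k}(a,u)$, where $a^k=(a^k_1,\ldots,a^k_{w(x_k)})$; set $t_k=\max\{\nu^q: q\in\mathbb{N}\cup\{0\},\ f^{a^k_j}(x_k+\nu^qu_k)\preceq f^{a^k_j}(x_k)+\beta\nu^q\nabla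 f^{a^k_j}(x_k)^\top u_k\ \text{for all } j\in[w(x_k)]\}$; set $x_{k+1}=x_k+t_ku_k$. *)

(* Defs.v *)
From HB Require Import structures.
From mathcomp Require Import all_boot all_order all_algebra.
From mathcomp Require Import finmap.
From mathcomp Require Import all_classical all_reals all_analysis.

Set Implicit Arguments.
Unset Strict Implicit.
Unset Printing Implicit Defensive.

Import Order.TTheory GRing.Theory Num.Theory.
Import numFieldNormedType.Exports.

Local Open Scope classical_set_scope.
Local Open Scope ring_scope.

(* Vectors of R^n are row vectors, so the Jacobian of f at x applied to u is
   u *m 'J f x.  The library norm `|x| on 'rV[R]_n is the max norm; it is only
   used through the topology and boundedness, which do not depend on the choice
   of the norm. *)

Section Extrema.
Variable R : realType.

Definition is_min (A : set R) (t : R) : Prop := A t /\ lbound A t.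

Definition is_max (A : set R) (t : R) : Prop := A t /\ ubound A t.

(* The value is 0 if the extremum does not exist. *)
Definition set_min (A : set R) : R := xget 0 (is_min A).

Definition set_max (A : set R) : R := xget 0 (is_max A).

End Extrema.

Section Calculus.
Variables (R : realType) (n : nat).

Definition enorm (x : 'rV[R]_n) : R := Num.sqrt (\sum_j x 0 j ^+ 2).

(* Continuity of the derivative is expressed by the partial derivatives, as the
   library has no topology on spaces of linear maps. *)
Definition cont_diff (W : normedModType R) (g : 'rV[R]_n -> W) : Prop :=
  (forall x, differentiable g x) /\
  (forall j : 'I_n, continuous ('D_(delta_mx 0 j) g)).

Definition twice_cont_diff (m : nat) (f : 'rV[R]_n -> 'rV[R]_m) : Prop :=
  cont_diff f /\ cont_diff (fun x => 'J f x).

Definition hessian (g : 'rV[R]_n -> R^o) (x : 'rV[R]_n) : 'M[R]_n :=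
  \matrix_(i, j) 'D_(delta_mx 0 i) ('D_(delta_mx 0 j) g) x.

Definition hess_quad (m : nat) (f : 'rV[R]_n -> 'rV[R]_m) (x u : 'rV[R]_n) :
    'rV[R]_m :=
  \row_l (u *m hessian (fun y => f y 0 l) x *m u^T) 0 0.

End Calculus.

Section Cones.
Variables (R : realType) (m : nat).
Implicit Types (K A : set 'rV[R]_m) (e y z : 'rV[R]_m).

Definition is_cone K : Prop :=
  forall (t : R) z, 0 <= t -> K z -> K (t *: z).

Definition pointed_cone K : Prop := K `&` [set - z | z in K] = [set 0].

Definition solid K : Prop := interior K !=set0.

Definition cone_le K y z : Prop := K (z - y).

Definition gerstewitz K e z : R :=
  set_min [set t : R | [set z + k | k in K] (t *: e)].

Definition Min A K : set 'rV[R]_m :=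
  [set z | A z /\ [set z - k | k in K] `&` A = [set z]].

Definition strongly_convex (n : nat) K e (rho : R)
    (f : 'rV[R]_n -> 'rV[R]_m) : Prop :=
  forall (x1 x2 : 'rV[R]_n) (lam : R), 0 <= lam <= 1 ->
    cone_le K (f (lam *: x1 + (1 - lam) *: x2))
      (lam *: f x1 + (1 - lam) *: f x2
       - (2^-1 * rho * lam * (1 - lam) * enorm (x1 - x2) ^+ 2) *: e).

End Cones.

Section SetOptimization.
#[local] Unset Implicit Arguments.
Variables (R : realType) (n m p : nat).
Variables (K : set 'rV[R]_m) (e : 'rV[R]_m).
Variable f : 'I_p -> 'rV[R]_n -> 'rV[R]_m.

Definition F (x : 'rV[R]_n) : set 'rV[R]_m := range (fun i => f i x).

Definition active (x : 'rV[R]_n) : set 'I_p :=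
  [set i | Min (F x) K (f i x)].

Definition active_at (r : 'rV[R]_m) (x : 'rV[R]_n) : set 'I_p :=
  [set i | active x i /\ f i x = r].

Definition w (x : 'rV[R]_n) : nat := #|` fset_set (Min (F x) K)|%fset.

Definition enumerates_min (r : forall x : 'rV[R]_n, 'I_(w x) -> 'rV[R]_m) :
    Prop :=
  forall x, set_bij [set: 'I_(w x)] (Min (F x) K) (r x).

Variable r : forall x : 'rV[R]_n, 'I_(w x) -> 'rV[R]_m.

Definition partition_set (x : 'rV[R]_n) : set ('I_(w x) -> 'I_p) :=
  [set a | forall j, active_at (r x j) x (a j)].

Definition stationary (x : 'rV[R]_n) : Prop :=
  forall a, partition_set x a -> forall u : 'rV[R]_n,
    exists j, ~ [set - z | z in interior K] (u *m 'J (f (a j)) x).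

Definition xi (x : 'rV[R]_n) (a : 'I_(w x) -> 'I_p) (u : 'rV[R]_n) : R :=
  set_max (range (fun j => gerstewitz K e
    (u *m 'J (f (a j)) x + 2^-1 *: hess_quad (f (a j)) x u))).

Definition newton_choice (x : 'rV[R]_n) (a : 'I_(w x) -> 'I_p)
    (u : 'rV[R]_n) : Prop :=
  partition_set x a /\
  forall a' u', partition_set x a' -> xi x a u <= xi x a' u'.

Definition armijo (beta nu : R) (x : 'rV[R]_n) (a : 'I_(w x) -> 'I_p)
    (u : 'rV[R]_n) : set nat :=
  [set q | forall j, cone_le K (f (a j) (x + nu ^+ q *: u))
             (f (a j) x + (beta * nu ^+ q) *: (u *m 'J (f (a j)) x))].

Record newton_run (beta nu : R) (x : nat -> 'rV[R]_n)
    (a : forall k, 'I_(w (x k)) -> 'I_p) (u : nat -> 'rV[R]_n)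
    (t : nat -> R) : Prop := NewtonRun {
  newton_choiceP : forall k, newton_choice (x k) (a k) (u k);
  newton_stepP : forall k,
    is_max [set nu ^+ q | q in armijo beta nu (x k) (a k) (u k)] (t k);
  newton_nextP : forall k, x k.+1 = x k + t k *: u k
}.

End SetOptimization.

Arguments F {R n m p} f x.
Arguments active {R n m p} K f x.
Arguments active_at {R n m p} K f r x.
Arguments w {R n m p} K f x.
Arguments enumerates_min {R n m p} K f r.
Arguments partition_set {R n m p} K f r x.
Arguments stationary {R n m p} K f r x.
Arguments xi {R n m p} K e f x a u.
Arguments newton_choice {R n m p} K e f r x a u.
Arguments armijo {R n m p} K f beta nu x a u.
Arguments newton_run {R n m p} K e f r beta nu x a u t.

(* Main.v *)
(* Testing the Newton subproblem with the zero direction gives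
   J u + H(u) / 2 in -K for every selected f^i at x_k, while strong convexity
   gives H(u) - rho |u|^2 e in K. As e is interior, C |J u| e + J u lies in K for
   a fixed C, so summing up (C |J u| - rho |u|^2 / 2) e is in K and
   |u| <= C' |J| for the Jacobian J at x_k. Along a convergent sequence the
   Jacobians are bounded. *)

Require Import Defs.
From HB Require Import structures.
From mathcomp Require Import all_boot all_order all_algebra.
From mathcomp Require Import finmap.
From mathcomp Require Import all_classical all_reals all_analysis.
From mathcomp Require Import ring lra.

Set Implicit Arguments.
Unset Strict Implicit.
Unset Printing Implicit Defensive.

Import Order.TTheory GRing.Theory Num.Theory.
Import numFieldNormedType.Exports.

Local Open Scope classical_set_scope.
Local Open Scope ring_scope.

(** * Cones with an interior point, and the Gerstewitz function *)

Section ClosedCone.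
Variables (R : realType) (m : nat) (K : set 'rV[R]_m) (e : 'rV[R]_m).
Hypotheses (K_convex : convex_set K) (K_cone : is_cone K).
Implicit Types y z : 'rV[R]_m.

(** Convexity gives the midpoint, and the cone property doubles it. *)
Lemma coneD y z : K y -> K z -> K (y + z).
Proof.
move=> Ky Kz.
have h01 : 0 <= (2^-1 : R) <= 1 by lra.
have := K_convex (x := y) (y := z)
  (Itv01 (proj1 (andP h01)) (proj2 (andP h01))).
rewrite !inE => /(_ Ky Kz) /(K_cone (ler0n _ 2)).
rewrite /conv /= /unstable.onem scalerDr !scalerA divff ?pnatr_eq0//.
by rewrite (_ : 2 * (1 - 2^-1) = 1 :> R) ?scale1r//; field.
Qed.

Hypothesis e_int : interior K e.

Lemma cone_interior_in : K e.
Proof. exact: nbhs_singleton. Qed.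

Lemma cone0 : K 0.
Proof.
by rewrite -(scale0r e); apply: K_cone => //; exact: cone_interior_in.
Qed.

(** A ball of radius [d] about [e] lies in [K]. It contains [e] plus [z] rescaled to norm [d / 2],
    and multiplying that point by 2 |z| / [d] gives the claim. *)
Lemma cone_interior_absorbs : exists2 C : R, 0 < C &
  forall z, K ((C * `|z|) *: e + z).
Proof.
have /nbhs_ballP[d /= d0 dK] := e_int.
exists (2 / d) => [|z]; first by rewrite divr_gt0.
have [->|z0] := eqVneq z 0.
  by rewrite normr0 mulr0 scale0r addr0; exact: cone0.
have nz0 : 0 < `|z| by rewrite normr_gt0.
have c0 : 0 < 2 / d * `|z| by rewrite mulr_gt0// divr_gt0.
rewrite (_ : _ + z = (2 / d * `|z|) *: (e + (2 / d * `|z|)^-1 *: z));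
  last first.
  by rewrite scalerDr scalerA divff ?gt_eqF// scale1r.
apply: K_cone; first exact: ltW.
apply: dK; rewrite -ball_normE/= opprD addrA subrr sub0r normrN normrZ.
rewrite gtr0_norm ?invr_gt0// invfM -mulrA mulVf ?gt_eqF// mulr1.
by rewrite invf_div ltr_pdivrMr// ltr_pMr// ltr1n.
Qed.

Hypotheses (m_gt0 : (0 < m)%N) (K_pointed : pointed_cone K).

Lemma pointed_cone_eq0 z : K z -> K (- z) -> z = 0.
Proof.
move=> Kz KNz; have : (K `&` [set - y | y in K]) z.
  by split=> //; exists (- z) => //; rewrite opprK.
by rewrite K_pointed.
Qed.

(** A negative [s] would put -[e] in [K], so [e] = 0 by pointedness. Then absorption makes [K] the
    whole space, which is not pointed as [m] > 0. *)
Lemma cone_scale_ge0 (s : R) : K (s *: e) -> 0 <= s.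
Proof.
move=> Kse; rewrite leNgt; apply/negP => s0.
have e0 : e = 0.
  apply: pointed_cone_eq0; first exact: cone_interior_in.
  have -> : - e = (- s^-1) *: (s *: e).
    by rewrite scalerA mulNr mulVf ?lt_eqF// scaleN1r.
  by apply: K_cone => //; rewrite oppr_ge0 invr_le0 ltW.
have [C _ Cabs] := cone_interior_absorbs.
have K1 z : K z by have := Cabs z; rewrite e0 scaler0 add0r.
have /rowP/(_ (Ordinal m_gt0)) := pointed_cone_eq0 (K1 (const_mx 1)) (K1 _).
by rewrite !mxE => /eqP; rewrite oner_eq0.
Qed.

Hypothesis K_closed : closed K.

(** The minimum is attained, so [gerstewitz] never takes the default value of [set_min]: the set is
    nonempty by absorption of -[z], bounded below and closed. *)
Lemma gerstewitz_min z : is_min [set t : R | K (t *: e - z)] (gerstewitz K e z).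
Proof.
rewrite /gerstewitz /set_min.
have -> : [set t : R | [set z + k | k in K] (t *: e)] =
    [set t | K (t *: e - z)].
  apply/seteqP; split=> t /=; first by case=> k Kk <-; rewrite addrC addKr.
  by exists (t *: e - z) => //; rewrite addrC subrK.
set A := [set t | _]; apply: xgetPex.
have [C C0 Cabs] := cone_interior_absorbs.
have A0 : A !=set0 by exists (C * `|- z|); rewrite /A/=.
(* Adding [t *: e - z] to the absorbed vector for [z] cancels [z] and leaves ([t] + [C] |z|) [e] in
   [K]. *)
have Alb : lbound A (- (C * `|z|)).
  move=> t At; rewrite -subr_ge0 opprK; apply: cone_scale_ge0.
  have := coneD At (Cabs z).
  by rewrite addrACA addNr addr0 -scalerDl.
have Ainf : has_inf A by split=> //; exists (- (C * `|z|)).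
exists (inf A); split; last by apply: inf_lbound; exists (- (C * `|z|)).
have cA : closed A.
  apply: (@preimage_closed _ _ (fun t : R => t *: e - z)) K_closed => t _.
  by apply: cvgB; [exact: cvgZr_tmp|exact: cvg_cst].
apply: cA => B /nbhs_ballP[d /= d0 dB].
have [t At tlt] := inf_adherent d0 Ainf.
exists t; split=> //; apply: dB; rewrite -ball_normE/= distrC.
rewrite ger0_norm ?subr_ge0; first by rewrite ltrBlDl.
by apply: ge_inf At; exists (- (C * `|z|)).
Qed.

Lemma gerstewitz_le0_cone z : gerstewitz K e z <= 0 -> K (- z).
Proof.
move=> ge_le0; have [/= Kz _] := gerstewitz_min z.
have -> : - z = (gerstewitz K e z *: e - z) + (- gerstewitz K e z) *: e.
  by rewrite scaleNr addrAC subrr add0r.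
apply: coneD => //; apply: K_cone; first by rewrite oppr_ge0.
exact: cone_interior_in.
Qed.

Lemma gerstewitz0 : gerstewitz K e 0 <= 0.
Proof.
by have [_ /= ->//] := gerstewitz_min 0; rewrite /= scale0r subr0; exact: cone0.
Qed.

End ClosedCone.

(** * Norm estimates and the Hessian as a derivative of the Jacobian *)

Section Calculus.
Variables (R : realType) (n m : nat).

Lemma normr_mulmx (v : 'rV[R]_n) (M : 'M[R]_(n, m)) :
  `|v *m M| <= n%:R * (`|v| * `|M|).
Proof.
rewrite [leLHS]/Num.Def.normr/= mx_normrE bigmax_le ?mulr_ge0// => -[i j] _ /=.
rewrite mxE; apply: le_trans (ler_norm_sum _ _ _) _.
have -> : n%:R * (`|v| * `|M|) = \sum_(k < n) (`|v| * `|M|).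
  by rewrite sumr_const card_ord mulr_natl.
apply: ler_sum => k _; rewrite normrM ler_pM//.
- rewrite [leRHS]/Num.Def.normr/= mx_normrE.
  exact: (le_bigmax _ (fun ij => `|v ij.1 ij.2|) (i, k)).
- rewrite [leRHS]/Num.Def.normr/= mx_normrE.
  exact: (le_bigmax _ (fun ij => `|M ij.1 ij.2|) (k, j)).
Qed.

Lemma cvg_mulmxl (T : Type) (F : set_system T) (FF : Filter F)
    (v : 'rV[R]_n) (G : T -> 'M[R]_(n, m)) (L : 'M[R]_(n, m)) :
  G x @[x --> F] --> L -> v *m G x @[x --> F] --> v *m L.
Proof.
move=> GL; apply: (@continuous_cvg _ _ _ _ FF G (mulmx v) L _ GL).
apply: (@bounded_linear_continuous _ _ _
  (mulmx v : {linear 'M[R]_(n, m) -> 'rV[R]_m})).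
apply/ex_bound; exists (n%:R * (`|v| * 1)).
apply: filterS (nbhs0_le ltr01) => M M1.
apply: le_trans (normr_mulmx _ _) _.
by rewrite !ler_wpM2l.
Qed.

(** Strong convexity is stated with the Euclidean norm, boundedness with the max norm; this links
    the two. *)
Lemma sqr_normr_le_enorm (v : 'rV[R]_n) : `|v| ^+ 2 <= enorm v ^+ 2.
Proof.
have s0 : 0 <= \sum_j v 0 j ^+ 2 by apply: sumr_ge0 => j _; exact: sqr_ge0.
rewrite ler_pXn2r ?nnegrE ?sqrtr_ge0//.
rewrite [leLHS]/Num.Def.normr/= mx_normrE bigmax_le ?sqrtr_ge0// => -[i j] _ /=.
rewrite ord1 -sqrtr_sqr ler_wsqrtr// (bigD1 j)//= lerDl.
by apply: sumr_ge0 => k _; exact: sqr_ge0.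
Qed.

Lemma sqr_enormZ (c : R) (v : 'rV[R]_n) :
  enorm (c *: v) ^+ 2 = c ^+ 2 * enorm v ^+ 2.
Proof.
rewrite /enorm !sqr_sqrtr; first last.
- by apply: sumr_ge0 => k _; exact: sqr_ge0.
- by apply: sumr_ge0 => k _; exact: sqr_ge0.
by rewrite mulr_sumr; apply: eq_bigr => j _; rewrite mxE exprMn.
Qed.

Lemma derive_sum_basis (W : normedModType R) (g : 'rV[R]_n -> W)
    (x v : 'rV[R]_n) :
  differentiable g x -> 'D_v g x = \sum_i v 0 i *: 'D_(delta_mx 0 i) g x.
Proof.
move=> dg; rewrite deriveE// {1}(row_sum_delta v) linear_sum.
by apply: eq_bigr => i _; rewrite linearZ/= deriveE.
Qed.

(** Turns the componentwise second derivatives into one directional derivative of the Jacobian,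
    which is a limit of difference quotients. *)
Lemma hess_quadE (f : 'rV[R]_n -> 'rV[R]_m) (x v : 'rV[R]_n) :
  twice_cont_diff f -> hess_quad f x v = v *m 'D_v (jacobian f) x.
Proof.
move=> [[df _] [dJ _]]; rewrite derive_sum_basis//.
have JE y (l : 'I_m) (j : 'I_n) :
    'D_(delta_mx 0 j) (fun z => f z 0 l : R^o) y = ('J f y) j l.
  have := deriveEjacobian (delta_mx 0 j) (df y).
  rewrite derive_mx; last exact: diff_derivable.
  by move/rowP/(_ l); rewrite -rowE !mxE.
have HE l i j :
    hessian (fun y => f y 0 l) x i j = ('D_(delta_mx 0 i) (jacobian f) x) j l.
  rewrite mxE derive_mx; last exact: diff_derivable.
  rewrite [RHS]mxE.
  have -> : 'D_(delta_mx 0 j) (fun y => f y 0 l : R^o) =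
      fun y => jacobian f y j l.
    by apply/funext => y; rewrite JE.
  by [].
apply/rowP => l; rewrite !mxE; apply: eq_bigr => j _; rewrite !mxE [RHS]mulrC.
by congr (_ * _); rewrite summxE; apply: eq_bigr => i _; rewrite HE mxE.
Qed.

End Calculus.

(** * First- and second-order consequences of strong convexity *)

Section StrongConvexity.
Variables (R : realType) (n m : nat) (K : set 'rV[R]_m) (e : 'rV[R]_m).
Hypotheses (K_convex : convex_set K) (K_cone : is_cone K) (K_closed : closed K).
Variables (rho : R) (f : 'rV[R]_n -> 'rV[R]_m).
Hypothesis f_sconvex : strongly_convex K e rho f.

(** Divide the strong convexity inequality at [l *: y + (1 - l) *: x] by [l] and let [l] tend to 0
    from the right; closedness keeps the limit in [K]. *)
Lemma strongly_convex_gradient (x y : 'rV[R]_n) : differentiable f x ->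
  K (f y - f x - (y - x) *m 'J f x - (2^-1 * rho * enorm (y - x) ^+ 2) *: e).
Proof.
move=> df.
have Kq : \forall l \near 0^'+, K (f y - f x
    - l^-1 *: ((f \o shift x) (l *: (y - x)) - f x)
    - (2^-1 * rho * (1 - l) * enorm (y - x) ^+ 2) *: e).
  near=> l.
  have l0 : 0 < l by near: l; exact: nbhs_right_gt.
  have l1 : l <= 1 by near: l; exact: nbhs_right_le.
  have l01 : 0 <= l <= 1 by rewrite ltW.
  have il : 0 <= l^-1 by rewrite invr_ge0 ltW.
  have /(K_cone il) := f_sconvex y x l01.
  congr (K _).
  have -> : l *: y + (1 - l) *: x = l *: (y - x) + x.
    by apply/rowP => j; rewrite !mxE; ring.
  apply/rowP => j; rewrite /= !mxE; field.
  by rewrite gt_eqF.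
apply: (closed_cvg _ K_closed Kq).
rewrite -deriveEjacobian//.
apply: cvgB.
  apply: cvgB; first exact: cvg_cst.
  apply: cvg_dnbhs_at_right.
  exact: (diff_derivable df).
apply: cvgZr_tmp.
have -> : 2^-1 * rho * enorm (y - x) ^+ 2 =
    2^-1 * rho * (1 - 0) * enorm (y - x) ^+ 2.
  by rewrite subr0 mulr1.
apply: cvgMr_tmp; apply: cvgMl_tmp; apply: cvgB; first exact: cvg_cst.
exact/cvg_at_right_filter/cvg_id.
Unshelve. all: by end_near. Qed.

(* Second-order information is extracted from the first-order inequality alone:
   adding it at (x, x + s v) and (x + s v, x) gives strong monotonicity of the
   Jacobian, which is then divided by s^2. *)
Lemma strongly_convex_hess_quad (x v : 'rV[R]_n) : twice_cont_diff f ->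
  K (hess_quad f x v - (rho * enorm v ^+ 2) *: e).
Proof.
move=> f2; rewrite hess_quadE//.
(* Here [a], [b] stand for the values of [f] at x + s v and x, and [p], [q] for the Jacobians at x
   and x + s v applied to [v]. *)
have second_difference (s N : R) (a b p q : 'rV[R]_m) : s != 0 ->
    (s^-1 / s) *: (a - b - s *: p - (2^-1 * rho * (s ^+ 2 * N)) *: e +
      (b - a - - s *: q - (2^-1 * rho * (s ^+ 2 * N)) *: e)) =
    s^-1 *: (q - p) - (rho * N) *: e.
  by move=> s0; apply/rowP => j; rewrite !mxE; field.
have [[df _] [dJ _]] := f2.
have Kq : \forall s \near 0^'+, K (v *m
    (s^-1 *: ((jacobian f \o shift x) (s *: v) - 'J f x))
    - (rho * enorm v ^+ 2) *: e).
  near=> s.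
  have s0 : 0 < s by near: s; exact: nbhs_right_gt.
  have is0 : 0 <= s^-1 * s^-1 by rewrite mulr_ge0// invr_ge0 ltW.
  have := coneD K_convex K_cone (strongly_convex_gradient (s *: v + x) (df x))
    (strongly_convex_gradient x (df (s *: v + x))).
  have -> : s *: v + x - x = s *: v by rewrite addrK.
  have -> : x - (s *: v + x) = (- s) *: v
    by rewrite opprD addrCA subrr addr0 scaleNr.
  rewrite !sqr_enormZ sqrrN.
  move=> /(K_cone is0); congr (K _).
  rewrite /= -!scalemxAl -!scalemxAr mulmxBr.
  by apply: second_difference; rewrite gt_eqF.
apply: (closed_cvg _ K_closed Kq).
apply: cvgB; last exact: cvg_cst.
apply: cvg_mulmxl; apply: cvg_dnbhs_at_right.
exact: (diff_derivable (dJ x)).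
Unshelve. all: by end_near. Qed.

End StrongConvexity.

(** * Newton directions at a single point *)

Section NewtonDirection.
Variables (R : realType) (n m p : nat) (K : set 'rV[R]_m) (e : 'rV[R]_m).
Hypotheses (m_gt0 : (0 < m)%N) (K_closed : closed K) (K_convex : convex_set K).
Hypotheses (K_cone : is_cone K) (K_pointed : pointed_cone K).
Hypothesis e_int : interior K e.
Variable f : 'I_p -> 'rV[R]_n -> 'rV[R]_m.

Lemma set_max_range (I : finType) (i0 : I) (g : I -> R) :
  is_max (range g) (set_max (range g)).
Proof.
apply: xgetPex; have [i _ gi] := arg_maxP g (erefl (xpredT i0)).
by exists (g i); split=> [|_ [j _ <-]]; [exists i | exact: gi].
Qed.

(** Take [i] with the fewest values below [f i x]. If [f j x] is below it, transitivity and
    minimality force [below j] = [below i], which contains [i]; antisymmetry concludes. *)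
Lemma Min_F_nonempty (x : 'rV[R]_n) : (0 < p)%N -> Min (F f x) K !=set0.
Proof.
move=> p_gt0.
pose below i := [set j : 'I_p | `[< K (f i x - f j x) >]]%SET.
have [i _ imin] := @arg_minnP _ (Ordinal p_gt0) xpredT (fun i => #|below i|) isT.
exists (f i x); split; first by exists i.
apply/seteqP; split=> [_ [[k Kk <-]] [j _ fj]|_ ->] /=; last first.
  split; last by exists i.
  by exists 0; [exact: (@cone0 _ _ K e) | rewrite subr0].
have Kij : K (f i x - f j x) by rewrite fj opprB addrC subrK.
have sub : below j \subset below i.
  apply/fintype.subsetP => l; rewrite !inE => Kjl.
  by have := coneD K_convex K_cone Kij Kjl; rewrite addrA subrK.
have : i \in below j.
  have /eqP -> : below j == below i by rewrite eqEcard sub imin.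
  by rewrite inE; apply/asboolP; rewrite subrr; exact: (@cone0 _ _ K e).
rewrite inE => /asboolP Kji.
apply/eqP; rewrite -fj eq_sym -subr_eq0; apply/eqP.
by apply: pointed_cone_eq0 Kij _ => //; rewrite opprB.
Qed.

(** Optimality is compared with the pair ([a], 0), where every argument of [gerstewitz] vanishes.
    The index [j] also witnesses that both maxima run over nonempty sets, hence are attained. *)
Lemma newton_choice_descent
    (r : forall x : 'rV[R]_n, 'I_(w K f x) -> 'rV[R]_m)
    (x : 'rV[R]_n) (a : 'I_(w K f x) -> 'I_p) (u : 'rV[R]_n) (j : 'I_(w K f x)) :
  newton_choice K e f r x a u ->
  K (- (u *m 'J (f (a j)) x + 2^-1 *: hess_quad (f (a j)) x u)).
Proof.
move=> [Pa amin]; apply: (gerstewitz_le0_cone (e := e)) => //.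
apply: (@le_trans _ _ (xi K e f x a u)).
  by have [_] := set_max_range j (fun j => gerstewitz K e
    (u *m 'J (f (a j)) x + 2^-1 *: hess_quad (f (a j)) x u)); apply; exists j.
apply: le_trans (amin a 0 Pa) _; rewrite /xi.
have [[i _ <-] _] := set_max_range j (fun j => gerstewitz K e
    (0 *m 'J (f (a j)) x + 2^-1 *: hess_quad (f (a j)) x 0)).
rewrite (_ : hess_quad _ _ _ = 0); last first.
  by apply/rowP => l; rewrite mxE !mul0mx !mxE.
by rewrite mul0mx scaler0 addr0; exact: gerstewitz0.
Qed.

(** The quadratic lower bound on the Hessian term beats the linear Jacobian term. The constant is
    uniform in [x] and [u], as the passage to a sequence requires. *)
Lemma descent_direction_bound (rho : R) (g : 'rV[R]_n -> 'rV[R]_m) :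
  0 < rho -> strongly_convex K e rho g -> twice_cont_diff g ->
  exists2 C : R, 0 < C & forall x u : 'rV[R]_n,
    K (- (u *m 'J g x + 2^-1 *: hess_quad g x u)) -> `|u| <= C * `|'J g x|.
Proof.
move=> rho0 gconv g2.
have [C C0 Cabs] := cone_interior_absorbs K_cone e_int.
(* The 2 undoes the half in the Newton model, and the dimension comes from [normr_mulmx]; [n.+1]
   keeps the constant positive even for [n] = 0. *)
exists (2 * C * n.+1%:R / rho) => [|x u Ku]; first by rewrite divr_gt0// !mulr_gt0.
have half : (0 : R) <= 2^-1 by [].
have := coneD K_convex K_cone (coneD K_convex K_cone Ku (Cabs (u *m 'J g x)))
  (K_cone half (strongly_convex_hess_quad K_convex K_cone K_closed gconv x u g2)).
rewrite (_ : _ + _ + _ =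
  (C * `|u *m 'J g x| - 2^-1 * (rho * enorm u ^+ 2)) *: e); last first.
  move: (u *m _) (hess_quad _ _ _) (enorm u) => q h N.
  by apply/rowP => l; rewrite !mxE; field.
move/(cone_scale_ge0 K_cone e_int m_gt0 K_pointed).
have [-> _|u0] := eqVneq u 0.
  by rewrite normr0 mulr_ge0// divr_ge0// ltW// !mulr_gt0.
have nu0 : 0 < `|u| by rewrite normr_gt0.
rewrite subr_ge0 => h.
have : 2^-1 * rho * `|u| ^+ 2 <= C * n.+1%:R * `|'J g x| * `|u|.
  apply: (@le_trans _ _ (C * `|u *m 'J g x|)).
    apply: le_trans h; rewrite [leRHS]mulrA ler_wpM2l ?sqr_normr_le_enorm//.
    by rewrite mulr_ge0// ltW.
  rewrite -!mulrA ler_wpM2l ?(ltW C0)//; apply: le_trans (normr_mulmx _ _) _.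
  by rewrite (mulrC `|u|) ler_wpM2r ?mulr_ge0// ler_nat.
rewrite expr2 mulrA ler_pM2r// => h2.
by rewrite mulrAC ler_pdivlMr//; lra.
Qed.

End NewtonDirection.

(** * Uniform bound along the convergent sequence *)

Theorem theorem4p2 (R : realType) (n m p : nat)
    (m_gt0 : (0 < m)%N) (p_gt0 : (0 < p)%N)
    (K : set 'rV[R]_m)
    (K_closed : closed K) (K_convex : convex_set K) (K_cone : is_cone K)
    (K_pointed : pointed_cone K) (K_solid : solid K)
    (e : 'rV[R]_m) (e_int : interior K e)
    (f : 'I_p -> 'rV[R]_n -> 'rV[R]_m)
    (f_C2 : forall i, twice_cont_diff (f i))
    (rho : 'I_p -> R) (rho_gt0 : forall i, 0 < rho i)
    (f_sconvex : forall i, strongly_convex K e (rho i) (f i))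
    (r : forall x : 'rV[R]_n, 'I_(w K f x) -> 'rV[R]_m)
    (r_enum : enumerates_min K f r)
    (beta nu : R) (beta01 : 0 < beta < 1) (nu01 : 0 < nu < 1)
    (x : nat -> 'rV[R]_n) (a : forall k, 'I_(w K f (x k)) -> 'I_p)
    (u : nat -> 'rV[R]_n) (t : nat -> R)
    (run : newton_run K e f r beta nu x a u t)
    (x_nonstationary : forall k, ~ stationary K f r (x k))
    (x_cvg : cvgn x) :
  bounded_fun u.
Proof.
(* The selected indices vary with [k], so each [i] gets its own bound, valid at those [k] where
   [f i] satisfies the Newton inequality. *)
have /choice[B HB] : forall i, exists B : R, forall k,
    K (- (u k *m 'J (f i) (x k) + 2^-1 *: hess_quad (f i) (x k) (u k))) ->
    `|u k| <= B.
  move=> i.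
  have [C C0 HC] := descent_direction_bound m_gt0 K_closed K_convex K_cone
    K_pointed e_int (rho_gt0 i) (f_sconvex i) (f_C2 i).
  have Jcvg : cvgn (jacobian (f i) \o x).
    apply/cvg_ex; exists (jacobian (f i) (lim (x @ \oo))).
    apply: continuous_cvg x_cvg.
    by apply: differentiable_continuous; have [_ []] := f_C2 i.
  have /pinfty_ex_gt0[M _ /= HM] := cvg_seq_bounded Jcvg.
  exists (C * M) => k /HC /le_trans; apply.
  by rewrite ler_wpM2l ?(ltW C0)//; exact: HM.
(* The sum dominates every [B i], whichever index is selected at step [k]. *)
exists (\sum_i `|B i|); split=> [|M BM k _ /=]; first exact: num_real.
(* A minimal element and surjectivity of the enumeration supply a position [j], so that some index
   [a k j] is actually selected. *)
have [y ymin] := Min_F_nonempty K_convex K_cone K_pointed e_int f (x k) p_gt0.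
have [_ _ rsurj] := r_enum (x k).
have [j _ _] := rsurj _ ymin.
have [choice_k _ _] := run.
have Kj := newton_choice_descent m_gt0 K_closed K_convex K_cone K_pointed
  e_int j (choice_k k).
apply: le_trans (HB _ _ Kj) _; apply: le_trans (ler_norm _) _.
apply: le_trans (ltW BM).
by rewrite (bigD1 (a k j))//= lerDl sumr_ge0.
Qed.
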